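(* For natural numbers $n,M>0$, $spt^{*}_M(n)>spt^{-}_M(n)$.
   Context: $spt^{*}_M(n)$ is the total number of appearances of the smallest part, summed over all partitions of $n$ in which no part exceeds the smallest part plus $M$. $spt^{-}_M(n)$ is defined by the generating function $$\sum_{n\ge1}spt^{-}_M(n)q^n=\sum_{k\ge1}\frac{q^{kM+k}}{(1-q^{k})^2(1-q^{k+1})\cdots(1-q^{k+M})}.$$ (Combinatorially, $spt^{-}_M(n)$ counts, over partitions of $n$ whose parts are at most the smallest part plus $M$ and whose smallest part appears at least $M$ times, the number of appearances of the smallest part beyond the first $M$.) *)

(* Defs.v *)
From mathcomp Require Import all_boot all_order all_algebra.
From mathcomp Require Import zify.

Set Implicit Arguments.
Unset Strict Implicit.
Unset Printing Implicit Defensive.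

Import Order.TTheory GRing.Theory Num.Theory.

Definition is_partition (n : nat) (s : seq nat) : bool :=
  [&& sorted geq s, 0 \notin s & sumn s == n].

(* A partition is listed in weakly decreasing order, so its smallest part is
   its last entry. *)
Definition smallest_part (s : seq nat) : nat := last 0 s.

(* A partition of n has at most n parts, each at most n, so the finite type
   n.-bseq 'I_n.+1 (sequences of length at most n over {0, ..., n}) contains
   each partition of n, exactly once; see partition_bseq below. *)
Definition parts (n : nat) (p : n.-bseq 'I_n.+1) : seq nat :=
  [seq val i | i <- p].

Definition spt_star (M n : nat) : nat :=
  \sum_(p : n.-bseq 'I_n.+1 |
         is_partition n (parts p) &&
         all (fun x => x <= smallest_part (parts p) + M) (parts p))
     count_mem (smallest_part (parts p)) (parts p).

Local Open Scope ring_scope.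

(* Coefficient of q^n in the expansion in Z[[q]] of P / Q, for a denominator
   with constant term 1: 1 / Q is the geometric series in 1 - Q, whose terms
   (1 - Q)^m with m > n do not contribute to q^n. See ratcoefP below. *)
Definition ratcoef (P Q : {poly int}) (n : nat) : int :=
  (P * \sum_(m < n.+1) (1 - Q) ^+ m)`_n.

Definition spt_minus_num (M k : nat) : {poly int} := 'X^(k * M + k).

Definition spt_minus_den (M k : nat) : {poly int} :=
  (1 - 'X^k) ^+ 2 * \prod_(1 <= j < M.+1) (1 - 'X^(k + j)).

(* The k-th term of the generating function is divisible by q^k, so only the
   terms with k <= n contribute to q^n. See spt_minus_gf below. *)
Definition spt_minus (M n : nat) : int :=
  \sum_(1 <= k < n.+1) ratcoef (spt_minus_num M k) (spt_minus_den M k) n.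

Lemma partition_bseq (n : nat) (s : seq nat) :
  is_partition n s -> exists! p : n.-bseq 'I_n.+1, parts p = s.
Proof.
case/and3P=> _ s0 /eqP sn.
have le_n x : x \in s -> (x < n.+1)%N.
  rewrite ltnS -sn; elim: s {s0 sn} => //= y s IH.
  rewrite inE => /predU1P[->|/IH xs]; first exact: leq_addr.
  exact: leq_trans xs (leq_addl _ _).
have sz : (size s <= n)%N.
  rewrite -sn; elim: s s0 {sn le_n} => //= y s IH.
  rewrite inE negb_or eq_sym -lt0n => /andP[y0 /IH ss].
  by rewrite -add1n leq_add.
have szi : (size [seq inord x : 'I_n.+1 | x <- s] <= n)%N by rewrite size_map.
exists (Bseq szi); split.
  rewrite /parts /= -map_comp -[RHS]map_id; apply/eq_in_map => x xs /=.
  by rewrite inordK ?le_n.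
move=> p ps; apply/val_inj/(inj_map val_inj); rewrite -/(parts p) ps /=.
rewrite -map_comp -[RHS]map_id; apply/eq_in_map => x xs /=.
by rewrite inordK ?le_n.
Qed.

Lemma coef_exp0 (p : {poly int}) (m i : nat) :
  p`_0 = 0 -> (i < m)%N -> (p ^+ m)`_i = 0.
Proof.
move=> p0; elim: m i => // m IH i im; rewrite exprS coefM big1 // => -[[|j] ji] _ /=.
  by rewrite p0 mul0r.
by rewrite IH ?mulr0 //; lia.
Qed.

Lemma ratcoef_widen (P Q : {poly int}) (n N : nat) :
  Q`_0 = 1 -> (n <= N)%N ->
  (P * \sum_(m < N.+1) (1 - Q) ^+ m)`_n = ratcoef P Q n.
Proof.
move=> Q0 nN; rewrite /ratcoef !coefM; apply: eq_bigr => i _; congr (_ * _).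
rewrite !coef_sum (@big_ord_widen _ _ _ n.+1 N.+1 (fun m => ((1 - Q) ^+ m)`_(n - i))) //.
rewrite [RHS]big_mkcond; apply: eq_bigr => m _ /=.
case: ltnP => // nm; apply: coef_exp0; last lia.
by rewrite coefB coef1 Q0 subrr.
Qed.

Lemma ratcoefP (P Q : {poly int}) (n : nat) :
  Q`_0 = 1 -> \sum_(i < n.+1) Q`_i * ratcoef P Q (n - i) = P`_n.
Proof.
move=> Q0.
have -> : \sum_(i < n.+1) Q`_i * ratcoef P Q (n - i) =
          (Q * (P * \sum_(m < n.+1) (1 - Q) ^+ m))`_n.
  rewrite coefM; apply: eq_bigr => i _; congr (_ * _).
  by rewrite (@ratcoef_widen P Q _ n) ?leq_subr.
have e : Q * \sum_(m < n.+1) (1 - Q) ^+ m = 1 - (1 - Q) ^+ n.+1.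
  rewrite -[RHS]opprB subrX1 -mulNr; congr (_ * _).
  by rewrite opprB opprB addrCA subrr addr0.
rewrite mulrCA e mulrBr mulr1 coefB [X in _ - X]coefM big1 ?subr0 // => i _.
rewrite coef_exp0 ?mulr0 //; first by rewrite coefB coef1 Q0 subrr.
by rewrite ltnS leq_subr.
Qed.

Lemma spt_minus_den0 (M k : nat) : (0 < k)%N -> (spt_minus_den M k)`_0 = 1.
Proof.
move=> k0.
have h j : (0 < j)%N -> (1 - 'X^j : {poly int}).[0] = 1.
  by move=> j0; rewrite !hornerE expr0n eqn0Ngt j0 subr0.
rewrite -horner_coef0 /spt_minus_den hornerM horner_exp h // expr1n mul1r.
rewrite horner_prod big1 // => j _; apply: h; lia.
Qed.

Lemma spt_minus_gf (M n N : nat) : (n <= N)%N ->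
  \sum_(1 <= k < N.+1) ratcoef (spt_minus_num M k) (spt_minus_den M k) n =
  spt_minus M n.
Proof.
move=> nN; rewrite (@big_cat_nat _ _ _ n.+1) //= -[RHS]addr0; congr (_ + _).
rewrite big_nat big1 // => k /andP[nk _].
rewrite /ratcoef /spt_minus_num coefXnM ifT //; lia.
Qed.

(* Main.v *)
Require Import Defs.
From mathcomp Require Import all_boot all_order all_algebra.
From mathcomp Require Import zify ring.

(** A partition of [n] with smallest part [k] and all parts at most [k + M] is
    given by the multiplicities [f 0 > 0, f 1, ..., f M] of [k, ..., k + M].
    Expanding the [k]-th term of the generating function as a product of
    geometric series shows that [spt_minus] sums [max (f 0 - M) 0] over these
    data, whereas [spt_star] sums [f 0]. As [M > 0], every partition
    contributes strictly more to [spt_star], and the partition with the single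
    part [n] exists. *)

Set Implicit Arguments.
Unset Strict Implicit.
Unset Printing Implicit Defensive.

Import Order.TTheory GRing.Theory Num.Theory.

(** * Power series modulo ['X^N] *)

Section TruncatedSeries.

Local Open Scope ring_scope.

Definition eqXn (N : nat) (A B : {poly int}) : Prop :=
  exists E, A = B + E * 'X^N.

Lemma eqXnM N A B C D : eqXn N A B -> eqXn N C D -> eqXn N (A * C) (B * D).
Proof.
move=> [E ->] [F ->]; exists (B * F + E * D + E * F * 'X^N); ring.
Qed.

Lemma eqXn_prod1 N (I : Type) (r : seq I) (F : I -> {poly int}) :
  (forall i, eqXn N (F i) 1) -> eqXn N (\prod_(i <- r) F i) 1.
Proof.
move=> F1; elim/big_rec: _ => [|i A _ A1]; first by exists 0; rewrite mul0r addr0.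
by have := eqXnM (F1 i) A1; rewrite mulr1.
Qed.

(** With [G] the truncated geometric series in [1 - Q], the product [Q * G] differs from 1 by
    [(1 - Q) ^+ n.+1], which has no coefficient up to degree [n]. Thus a quotient can be read off
    any [S] that solves [Q * S = P] modulo ['X^(n.+1)]. *)
Lemma ratcoef_eqXn (P Q S : {poly int}) (n : nat) :
  Q`_0 = 1 -> eqXn n.+1 (Q * S) P -> ratcoef P Q n = S`_n.
Proof.
move=> Q0 [E QS]; rewrite /ratcoef.
have -> : P = Q * S - E * 'X^(n.+1) by rewrite QS addrK.
set G := \sum_(m < _) _.
have QG : Q * G = 1 - (1 - Q) ^+ n.+1.
  rewrite -[RHS]opprB subrX1 -mulNr; congr (_ * _); ring.
have -> : (Q * S - E * 'X^(n.+1)) * G =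
    S - S * (1 - Q) ^+ n.+1 - E * G * 'X^(n.+1).
  transitivity (S * (Q * G) - E * G * 'X^(n.+1)); first ring.
  by rewrite QG; ring.
rewrite !coefB coefMXn ltnSn subr0 coefM big1 ?subr0 // => i _.
by rewrite coef_exp0 ?mulr0 ?coefB ?coef1 ?Q0 ?subrr // ltnS leq_subr.
Qed.

Lemma geometric_eqXn N l : (0 < l)%N ->
  eqXn N ((1 - 'X^l) * \sum_(a < N) 'X^(a * l)) 1.
Proof.
move=> l0; exists (- 'X^(l * N - N)).
have -> : \sum_(a < N) 'X^(a * l) = \sum_(a < N) ('X^l : {poly int}) ^+ a.
  by apply: eq_bigr => a _; rewrite -exprM mulnC.
rewrite mulNr -exprD subnK ?leq_pmull // -[1 - 'X^l]opprB mulNr -subrX1.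
by rewrite -exprM opprB.
Qed.

(** Finite form of the series y/(1-y)^2 for the sum of b y^b, with its boundary terms. *)
Lemma derived_geometric_sum (y : {poly int}) r :
  (1 - y) ^+ 2 * \sum_(b < r) y ^+ b *+ b =
  y - y ^+ r *+ r + y ^+ r.+1 *+ r - y ^+ r.+1.
Proof.
elim: r => [|r IH]; first by rewrite big_ord0 !mulr0n; ring.
rewrite big_ord_recr /= mulrDr IH !exprS; ring.
Qed.

Lemma shifted_derived_geometric_eqXn N M k : (0 < k)%N ->
  eqXn N ((1 - 'X^k) ^+ 2 * \sum_(a < N) 'X^(a * k) *+ (a - M)) 'X^(k * M + k).
Proof.
move=> k0; set y : {poly int} := 'X^k.
have yN r : (N <= r)%N -> exists E, y ^+ r = E * 'X^N.
  move=> Nr; exists 'X^(k * r - N).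
  by rewrite -exprD subnK /y -?exprM //; nia.
have -> : 'X^(k * M + k) = y ^+ M.+1 by rewrite /y -exprM; congr ('X^_); lia.
(* If [N <= M], every coefficient [a - M] is 0 and [y ^+ M.+1] is itself a multiple of ['X^N].
   Otherwise the terms with [a < M] vanish, and [a = M + b] leaves [y ^+ M] times a derived
   geometric sum. *)
have [NM|MN] := leqP N M.
  have [E yE] := yN M.+1 (leqW NM); exists (- E).
  rewrite yE mulNr subrr big1 ?mulr0 // => a _.
  by rewrite (_ : (a - M)%N = 0%N) ?mulr0n //; have := ltn_ord a; lia.
have -> : \sum_(a < N) 'X^(a * k) *+ (a - M) =
          y ^+ M * \sum_(b < N - M) y ^+ b *+ b.
  have e a : 'X^(a * k) = y ^+ a by rewrite /y -exprM mulnC.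
  rewrite -(big_mkord xpredT (fun a => 'X^(a * k) *+ (a - M))).
  rewrite (big_cat_nat (leq0n M) (ltnW MN)) /= big_nat big1 ?add0r; last first.
    by move=> a /andP[_ aM]; rewrite (eqP (ltnW aM : (a - M == 0)%N)) mulr0n.
  rewrite -{1}[M]add0n big_addn big_mkord mulr_sumr; apply: eq_bigr => b _.
  by rewrite addnK e addnC exprD mulrnAr.
rewrite mulrCA derived_geometric_sum.
have [E yE] := yN N (leqnn N).
(* The boundary terms for [r = N - M], multiplied by [y ^+ M], all contain [y ^+ N = E * 'X^N]; this
   is the cofactor. *)
exists (E * (y *+ (N - M) - 1 *+ (N - M) - y)).
have yNM : y ^+ N = y ^+ M * y ^+ (N - M) by rewrite -exprD subnKC 1?ltnW.
transitivity (y ^+ M.+1 + (E * 'X^N) * (y *+ (N - M) - 1 *+ (N - M) - y)).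
  by rewrite -yE yNM !exprS; ring.
by move: (y ^+ M.+1) ('X^N) => z w; ring.
Qed.

End TruncatedSeries.

Lemma smallest_part_mem (s : seq nat) x :
  sorted geq s -> x \in s -> smallest_part s \in s /\ smallest_part s <= x.
Proof.
case: s => // y s; rewrite /smallest_part /= => ys xs; split; first exact: mem_last.
elim: s x y ys xs => [|z s IH] x y /=; first by rewrite inE => _ /eqP->.
case/andP=> yz zs; rewrite inE => /predU1P[->|]; last exact: IH.
by apply: leq_trans yz; apply: IH => //; rewrite mem_head.
Qed.

(** * Partitions encoded by multiplicities *)

Section Multiplicities.

Variables n M : nat.

Implicit Types (k : nat) (f : {ffun 'I_M.+1 -> 'I_n.+1}).

Definition weight k f : nat := \sum_j f j * (k + j).

Lemma ratcoef_spt_minus k : 0 < k ->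
  ratcoef (spt_minus_num M k) (spt_minus_den M k) n =
  Posz (\sum_(f | weight k f == n) (f ord0 - M)).
Proof.
move=> k0.
(* The numerator and the squared factor go to [j = 0], giving the coefficients [a - M]; each other
   [j] carries a plain geometric series. Exponents [a <= n] suffice modulo ['X^(n.+1)]. *)
pose F (j : 'I_M.+1) (a : 'I_n.+1) : {poly int} :=
  ('X^(a * (k + j))%N *+ (if j == ord0 then a - M else 1)%N)%R.
rewrite (@ratcoef_eqXn _ _ (\prod_j \sum_a F j a)%R); first 1 last.
- exact: spt_minus_den0.
- rewrite big_ord_recl /spt_minus_den /spt_minus_num big_add1 big_mkord mulrACA.
  rewrite -(mulr1 'X^(k * M + k)%N)%R; apply: eqXnM.
    by under eq_bigr do rewrite /F /= addn0; apply: shifted_derived_geometric_eqXn.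
  rewrite -big_split; apply: eqXn_prod1 => j.
  under eq_bigr do rewrite /F /= mulr1n.
  by apply: geometric_eqXn; rewrite addn_gt0 k0.
(* Expanding the product chooses one [a] for each [j], that is, a function [f]. *)
rewrite bigA_distr_bigA coef_sum /=.
have Ff f : (\prod_j F j (f j) = 'X^(weight k f) *+ (f ord0 - M))%R.
  rewrite /weight (big_morph _ (@exprD _ 'X%R) (expr0 _)) /=.
  rewrite (big_ord_recl M) [in RHS](big_ord_recl M) /F /= mulrnAl.
  by congr (_ * _ *+ _)%R; apply: eq_bigr.
under eq_bigr => f _ do rewrite Ff coefMn coefXn eq_sym -mulrnA mulnbl.
rewrite (raddf_sum Posz) [RHS]big_mkcond; apply: eq_bigr => f _ /=.
by case: eqP => // _; rewrite natz.
Qed.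

Definition seq_of_mult k f : seq nat :=
  sort geq (flatten [seq nseq (f j) (k + j) | j <- index_enum 'I_M.+1]).

Lemma count_seq_of_mult k f (j : 'I_M.+1) :
  count_mem (k + j) (seq_of_mult k f) = f j.
Proof.
rewrite /seq_of_mult (permP (permEl (perm_sort _ _))) count_flatten.
rewrite -map_comp sumnE big_map (bigD1 j) //= count_nseq /= eqxx mul1n.
rewrite big1 ?addn0 // => i ij; rewrite count_nseq /= eqn_add2l.
by rewrite (negbTE (_ : val i != val j)) ?mul0n.
Qed.

Lemma mem_seq_of_mult k f x :
  x \in seq_of_mult k f -> k <= x <= k + M.
Proof.
rewrite mem_sort => /flatten_mapP[j _]; rewrite mem_nseq => /andP[_ /eqP->].
by rewrite leq_addr leq_add2l -ltnS ltn_ord.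
Qed.

Lemma sumn_seq_of_mult k f : sumn (seq_of_mult k f) = weight k f.
Proof.
rewrite (perm_sumn (permEl (perm_sort _ _))) sumn_flatten -map_comp sumnE big_map.
by apply: eq_bigr => j _; rewrite /= sumn_nseq mulnC.
Qed.

Lemma sorted_seq_of_mult k f : sorted geq (seq_of_mult k f).
Proof. by apply: sort_sorted => x y; apply: leq_total. Qed.

Lemma smallest_seq_of_mult k f :
  0 < f ord0 -> smallest_part (seq_of_mult k f) = k.
Proof.
move=> f0; have kf : k \in seq_of_mult k f.
  by rewrite -has_pred1 has_count -[k in count_mem k]addn0 (count_seq_of_mult k f ord0).
have [/mem_seq_of_mult/andP[k_le _] le_k] :=
  smallest_part_mem (sorted_seq_of_mult k f) kf.
by apply/eqP; rewrite eqn_leq le_k.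
Qed.

(* The smallest part is [u.1.+1], so that it ranges over 1, ..., n. *)
Definition mult_data (u : 'I_n * {ffun 'I_M.+1 -> 'I_n.+1}) : bool :=
  (weight u.1.+1 u.2 == n) && (0 < u.2 ord0).

(** Under [mult_data], [pick] succeeds and the default [[bseq]] does not arise. *)
Definition partition_of_data (u : 'I_n * {ffun 'I_M.+1 -> 'I_n.+1}) :
    n.-bseq 'I_n.+1 :=
  odflt [bseq] [pick p | parts p == seq_of_mult u.1.+1 u.2].

Lemma is_partition_seq_of_mult k f :
  0 < k -> weight k f = n -> is_partition n (seq_of_mult k f).
Proof.
move=> k0 wf; rewrite /is_partition sorted_seq_of_mult sumn_seq_of_mult wf eqxx andbT.
by apply/negP => /mem_seq_of_mult; rewrite leqn0 eqn0Ngt k0.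
Qed.

Lemma parts_partition_of_data u : mult_data u ->
  parts (partition_of_data u) = seq_of_mult u.1.+1 u.2.
Proof.
case/andP=> /eqP wf _; rewrite /partition_of_data; case: pickP => [p /eqP //|no_p].
have [p [pE _]] := partition_bseq (is_partition_seq_of_mult (ltn0Sn _) wf).
by have := no_p p; rewrite pE eqxx.
Qed.

(** The smallest part recovers [k], and then counting [k + j] recovers [f j]. *)
Lemma partition_of_data_inj : {in mult_data &, injective partition_of_data}.
Proof.
move=> [k f] [l g] kf lg /(congr1 (@parts n)); rewrite !parts_partition_of_data //=.
have [[_ /= f0] [_ /= g0]] := (andP kf, andP lg) => fg.
have kl : k = l.
  by apply/val_inj/succn_inj; rewrite -(smallest_seq_of_mult k.+1 f0) fg smallest_seq_of_mult.
congr pair => //; apply/ffunP => j; apply/val_inj => /=.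
by rewrite -(count_seq_of_mult k.+1 f) fg kl count_seq_of_mult.
Qed.

(** By injectivity the sum runs over the image of [partition_of_data], a subset of the partitions in
    [spt_star], whose other terms are nonnegative. *)
Lemma sum_mult_data_le_spt_star :
  \sum_(u | mult_data u) u.2 ord0 <= spt_star M n.
Proof.
pose A := [set u | mult_data u].
have inj : {in A &, injective partition_of_data}.
  by move=> u v; rewrite !inE; apply: partition_of_data_inj.
have -> : \sum_(u | mult_data u) u.2 ord0 = \sum_(p in partition_of_data @: A)
    count_mem (smallest_part (parts p)) (parts p).
  rewrite big_imset //; apply: eq_big => u; first by rewrite inE.
  move=> du; have [_ f0] := andP du; rewrite parts_partition_of_data //.
  by rewrite smallest_seq_of_mult // -[X in count_mem X]addn0 (count_seq_of_mult _ _ ord0).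
rewrite /spt_star big_mkcond [leqRHS]big_mkcond; apply: leq_sum => p _.
case: imsetP => // -[u]; rewrite inE => du ->; rewrite ifT //.
have [/eqP wf f0] := andP du; rewrite parts_partition_of_data //.
rewrite is_partition_seq_of_mult // smallest_seq_of_mult //=.
by apply/allP => x /mem_seq_of_mult/andP[].
Qed.

Lemma spt_minus_mult_data :
  spt_minus M n = Posz (\sum_(u | mult_data u) (u.2 ord0 - M)).
Proof.
rewrite /spt_minus big_add1 /= big_mkord.
under [LHS]eq_bigr do rewrite ratcoef_spt_minus //.
rewrite -(raddf_sum Posz); congr Posz.
rewrite pair_big_dep [LHS]big_mkcond [RHS]big_mkcond; apply: eq_bigr => -[k f] _ /=.
rewrite /mult_data /=; case: eqP => //= _.
(* Data with [f ord0 = 0] contribute [0 - M = 0], so restricting to positive [f ord0] keeps the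
   sum. *)
by case: posnP => [->|_].
Qed.

End Multiplicities.

Theorem theorem3p2 (n M : nat) (hn : (0 < n)%N) (hM : (0 < M)%N) :
  (spt_minus M n < (spt_star M n)%:Z)%R.
Proof.
rewrite spt_minus_mult_data ltz_nat.
apply: leq_trans (sum_mult_data_le_spt_star n M).
have n1 : n.-1 < n by rewrite prednK.
(* The single part [n], encoded as [n.-1] because of the shift in [mult_data]. *)
pose u : 'I_n * {ffun 'I_M.+1 -> 'I_n.+1} :=
  (Ordinal n1, [ffun j => if j == ord0 then inord 1 else ord0]).
have u0 : u.2 ord0 = 1 :> nat by rewrite ffunE eqxx inordK.
have du : mult_data u.
  rewrite /mult_data u0 andbT /weight (bigD1 ord0) //= u0 mul1n addn0 prednK //.
  by rewrite big1 ?addn0 // => j /negbTE j0; rewrite ffunE j0.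
(* At [u] the two contributions are [1 - M = 0] and 1, which gives strictness; elsewhere a weak
   inequality is enough. *)
rewrite (bigD1 u) // [ltnRHS](bigD1 u) //= -addSn leq_add //.
  by rewrite u0; lia.
by apply: leq_sum => v _; apply: leq_subr.
Qed.
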